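(* Suppose both Hamiltonians are linear in $p$, i.e. $H(q,p)=\langle p,f(q)\rangle$ and $\mathcal{H}(q,p)=\langle p,\sigma(q)\rangle$ with $f\in C^\infty(\mathbb{R}^N,\mathbb{R}^N)$ and $\sigma\in C^\infty(\mathbb{R}^N,\mathcal{L}(\mathbb{R}^K,\mathbb{R}^N))$. Then the rough Galerkin integrator $(q_k,p_k)\mapsto(q_{k+1},p_{k+1})$ preserves the canonical (Liouville) $1$-form between time steps: $$p_k\,\mathrm{d}q_k=p_{k+1}\,\mathrm{d}q_{k+1}.$$
   Context: Let $\mathbf{Z}$ be a geometric $\alpha$-Hölder rough path in $\mathbb{R}^K$ over $[t_0,t_1]$, $\alpha\in(\frac13,\frac12]$, with increment $Z_{t_k,t_{k+1}}=Z_{t_{k+1}}-Z_{t_k}\in\mathbb{R}^K$ on a step $[t_k,t_{k+1}]$ of length $\Delta t$. For $\mathcal{H}=(H_1,\dots,H_K)^T$, $\mathcal{H}\cdot Z_{t_k,t_{k+1}}:=\sum_jH_jZ^j_{t_k,t_{k+1}}$, and $[\langle p,\sigma(q)\rangle]_j=\sum_{i=1}^Np_i\sigma_{ij}(q)$. Rough Galerkin integrator: let $0=d_0<d_1<\dots<d_s=1$ be control points, $l_0,\dots,l_s$ the degree-$s$ Lagrange polynomials with $l_\mu(d_\nu)=\delta_{\mu\nu}$, and $$q_d(t_k+\eta\Delta t)=\sum_{\mu=0}^sq^\mu l_\mu(\eta),\qquad\dot q_d(t_k+\eta\Delta t)=\frac1{\Delta t}\sum_{\mu=0}^sq^\mu\dot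 l_\mu(\eta),\qquad q^\mu\in\mathbb{R}^N.$$ Let $0\le c_1\le\dots\le c_r\le1$ be quadrature points with weights $b_i$ (for $dt$) and $\bar b_i$ (for $d\mathbf{Z}$), $Q_{i,k}=q_d(t_k+c_i\Delta t)$, and let $P_{i,k}\in\mathbb{R}^N$, $i=1,\dots,r$, be free momentum values. The discrete generating function is $$\mathcal{S}_d(q_k,p_{k+1})=\underset{P_{i,k},\,q^\mu;\;q^0=q_k}{\mathrm{ext}}\Big[p_{k+1}q^s-\Delta t\sum_{i=1}^rb_i\big(P_{i,k}\dot q_d(t_k+c_i\Delta t)-H(Q_{i,k},P_{i,k})\big)+\sum_{i=1}^r\bar b_i\mathcal{H}(Q_{i,k},P_{i,k})\cdot Z_{t_k,t_{k+1}}\Big],$$ where ext denotes the stationary value over $q^1,\dots,q^s$ and $P_{1,k},\dots,P_{r,k}$, and the integrator is defined by $p_k=\frac{\partial\mathcal{S}_d}{\partial q_k}(q_k,p_{k+1})$, $q_{k+1}=\frac{\partial\mathcal{S}_d}{\partial p_{k+1}}(q_k,p_{k+1})$ (so $q_{k+1}=q^s$). Standing assumption: the method is solvable, i.e. the stationarity conditions determine $q^\mu,P_{i,k}$ as smooth functions of $(q_k,p_{k+1})$, $\mathcal{S}_d$ is smooth, and the last two relations define the map $(q_k,p_k)\mapsto(q_{k+1},p_{k+1})$. $p\,\mathrm{d}q=\sum_ip_i\,\mathrm{d}q^i$. *)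

(* Defs.v *)
From HB Require Import structures.
From mathcomp Require Import all_boot all_order all_algebra.
From mathcomp Require Import all_classical all_reals all_analysis.

Set Implicit Arguments.
Unset Strict Implicit.
Unset Printing Implicit Defensive.

Import Order.TTheory GRing.Theory Num.Theory.
Import numFieldNormedType.Exports.

Local Open Scope classical_set_scope.
Local Open Scope ring_scope.

(* C^k on an open set. On a finite-dimensional V (the only case used), C^{k+1}
   means: differentiable, with every directional derivative of class C^k. *)
Fixpoint Ck (R : realType) (V W : normedModType R) (k : nat) (U : set V)
    (f : V -> W) : Prop :=
  match k with
  | 0 => forall x, U x -> {for x, continuous f}
  | k'.+1 => (forall x, U x -> differentiable f x) /\
             (forall v : V, Ck k' U (fun x => 'D_v f x))
  end.

Definition smooth_on (R : realType) (V W : normedModType R) (U : set V)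
  (f : V -> W) : Prop := forall k, Ck k U f.

Definition dot (R : realType) (n : nat) (x y : 'rV[R]_n) : R :=
  \sum_(i < n) x 0 i * y 0 i.

(** Geometric rough paths *)

Definition incr (R : realType) (K : nat) (Z : R -> 'rV[R]_K) (u v : R) :
  'rV[R]_K := Z v - Z u.

(* second level of the canonical lift of a smooth path z:
   int_u^v (z^i_w - z^i_u) dz^j_w *)
Definition lift2 (R : realType) (K : nat) (z : R -> 'rV[R]_K) (u v : R) :
    'M[R]_K :=
  \matrix_(i, j) (\int[lebesgue_measure]_(w in `[u, v])
    ((z w 0 i - z u 0 i) * derive1 (fun w' : R => z w' 0 j) w)).

Definition holder2 (R : realType) (K : nat) (alpha t0 t1 : R)
    (D : R -> R -> 'rV[R]_K) (DD : R -> R -> 'M[R]_K) (C : R) : Prop :=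
  forall u v, t0 <= u -> u <= v -> v <= t1 ->
    `|D u v| <= C * (v - u) `^ alpha /\
    `|DD u v| <= C * (v - u) `^ (2 * alpha).

(* An alpha-Hölder rough path (Z, ZZ) over [t0, t1] (Hölder bounds and Chen's
   relation), geometric in the sense of being a limit, in the alpha-Hölder
   rough path metric, of canonical lifts of smooth paths. *)
Record geometric_rough_path (R : realType) (K : nat) (alpha t0 t1 : R)
    (Z : R -> 'rV[R]_K) (ZZ : R -> R -> 'M[R]_K) : Prop := {
  grp_holder : exists C : R, holder2 alpha t0 t1 (incr Z) ZZ C ;
  grp_chen : forall u v w, t0 <= u -> u <= v -> v <= w -> w <= t1 ->
    ZZ u w = ZZ u v + ZZ v w + (incr Z u v)^T *m incr Z v w ;
  grp_geometric : exists z : nat -> R -> 'rV[R]_K,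
    (forall n, smooth_on (V := R) [set: R] (z n)) /\
    (forall e : R, 0 < e -> \forall n \near \oo,
       holder2 alpha t0 t1
         (fun u v => incr Z u v - incr (z n) u v)
         (fun u v => ZZ u v - lift2 (z n) u v) e)
}.

(** The rough Galerkin integrator *)

Record galerkin (R : realType) (s r : nat) := Galerkin {
  ctrl : 'I_s.+1 -> R ;
  node : 'I_r -> R ;
  wt : 'I_r -> R ;
  rwt : 'I_r -> R ;
  ctrl_first : ctrl ord0 = 0 ;
  ctrl_last : ctrl ord_max = 1 ;
  ctrl_mono : forall mu nu : 'I_s.+1, (mu < nu)%N -> ctrl mu < ctrl nu ;
  node_mono : forall i j : 'I_r, (i <= j)%N -> node i <= node j ;
  node_bnd : forall i : 'I_r, 0 <= node i <= 1
}.

Definition lagr (R : realType) (s r : nat) (G : galerkin R s r)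
    (mu : 'I_s.+1) : {poly R} :=
  \prod_(nu < s.+1 | nu != mu)
    ((ctrl G mu - ctrl G nu)^-1 *: ('X - (ctrl G nu)%:P)).

(* q_d and its time derivative at t_k + eta * dt; row mu of qs is q^mu *)
Definition qd (R : realType) (N s r : nat) (G : galerkin R s r)
    (qs : 'M[R]_(s.+1, N)) (eta : R) : 'rV[R]_N :=
  \sum_(mu < s.+1) (lagr G mu).[eta] *: row mu qs.

Definition qd_dot (R : realType) (N s r : nat) (G : galerkin R s r) (dt : R)
    (qs : 'M[R]_(s.+1, N)) (eta : R) : 'rV[R]_N :=
  dt^-1 *: \sum_(mu < s.+1) ((lagr G mu)^`()).[eta] *: row mu qs.

(* The bracket whose stationary value is S_d. Argument y = (q_k, p_{k+1}); the
   free variables are w.1, with rows q^1, ..., q^s, and w.2, with rows P_i;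
   the constraint q^0 = q_k is built in by stacking q_k on top of w.1. *)
Definition action (R : realType) (N K s r : nat) (G : galerkin R s r)
    (H : 'rV[R]_N -> 'rV[R]_N -> R) (HH : 'rV[R]_N -> 'rV[R]_N -> 'rV[R]_K)
    (dt : R) (dZ : 'rV[R]_K) (y : 'rV[R]_N * 'rV[R]_N)
    (w : 'M[R]_(s, N) * 'M[R]_(r, N)) : R :=
  let qs : 'M[R]_(s.+1, N) := col_mx y.1 w.1 in
  let Q i := qd G qs (node G i) in
  let P i := row i w.2 in
  dot y.2 (row ord_max qs)
  - dt * (\sum_(i < r) wt G i *
            (dot (P i) (qd_dot G dt qs (node G i)) - H (Q i) (P i)))
  + \sum_(i < r) rwt G i * dot (HH (Q i) (P i)) dZ.

Definition stationary (R : realType) (V : normedModType R) (F : V -> R)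
  (w : V) : Prop := forall v : V, is_derive w v F 0.

Definition grad1 (R : realType) (N : nat) (S : 'rV[R]_N * 'rV[R]_N -> R)
    (y : 'rV[R]_N * 'rV[R]_N) : 'rV[R]_N :=
  \row_i 'D_((delta_mx 0 i, 0) : 'rV[R]_N * 'rV[R]_N) S y.

Definition grad2 (R : realType) (N : nat) (S : 'rV[R]_N * 'rV[R]_N -> R)
    (y : 'rV[R]_N * 'rV[R]_N) : 'rV[R]_N :=
  \row_i 'D_((0, delta_mx 0 i) : 'rV[R]_N * 'rV[R]_N) S y.

(* Solvability of the method with bracket A, and its one-step map Phi.
   Implicit schemes are in general only locally solvable, hence the open sets
   U (of pairs (q_k, p_{k+1})), W (of the unknowns) and D (of pairs
   (q_k, p_k)); global solvability is the case where all three are setT.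
   X y is the stationary point selected at y, so y |-> A y (X y) is S_d. *)
Record galerkin_map (R : realType) (N s r : nat)
    (A : 'rV[R]_N * 'rV[R]_N -> 'M[R]_(s, N) * 'M[R]_(r, N) -> R)
    (U D : set ('rV[R]_N * 'rV[R]_N)) (W : set ('M[R]_(s, N) * 'M[R]_(r, N)))
    (X : 'rV[R]_N * 'rV[R]_N -> 'M[R]_(s, N) * 'M[R]_(r, N))
    (Phi : 'rV[R]_N * 'rV[R]_N -> 'rV[R]_N * 'rV[R]_N) : Prop := {
  gm_openU : open U ;
  gm_openD : open D ;
  gm_openW : open W ;
  gm_inW : forall y, U y -> W (X y) ;
  gm_stationary : forall y w, U y -> W w ->
    (stationary (A y) w <-> w = X y) ;
  gm_smoothX : smooth_on U X ;
  gm_smoothS : smooth_on (W := R) U (fun y => A y (X y)) ;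
  gm_map : forall q p q' p', D (q, p) ->
    (Phi (q, p) = (q', p') <->
     [/\ U (q, p'),
         p = grad1 (fun y => A y (X y)) (q, p') &
         q' = grad2 (fun y => A y (X y)) (q, p')]) ;
  gm_diffPhi : forall x, D x -> differentiable Phi x
}.

(** 1-forms on phase space *)

Definition one_form (R : realType) (V : normedModType R) := V -> V -> R.

Definition pullback (R : realType) (V : normedModType R) (Phi : V -> V)
  (omega : one_form V) : one_form V := fun x v => omega (Phi x) ('d Phi x v).

(* p dq at the point x = (q, p) on the tangent vector v = (dq, dp) *)
Definition liouville (R : realType) (N : nat) :
  one_form ('rV[R]_N * 'rV[R]_N)%type := fun x v => dot x.2 v.1.
Arguments liouville {R} N.

(* Main.v *)
Require Import Defs.
From mathcomp Require Import all_boot all_order all_algebra.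
From mathcomp Require Import all_classical all_reals all_analysis.
From mathcomp Require Import ring.
Import Order.TTheory GRing.Theory Num.Theory.
Import numFieldNormedType.Exports.
Local Open Scope classical_set_scope.
Local Open Scope ring_scope.

(** Write the bracket as [p' . q^s + L(q, w, P)], with [w] the interior control
    values.  When both Hamiltonians are linear in the momentum, [L] is linear in
    the internal momenta [P].  Stationarity in the direction of [P] itself is
    Euler's relation for [L], so [L] vanishes at the stationary point and the
    generating function takes the value [S(q, p') = p' . q^s]
    ([stationary_action_value]).

    By the envelope principle ([envelope]), differentiating [S] in [p'] only sees
    the explicit occurrence of [p'], so [dS/dp' = q^s = q'].  Hence [S] is
    homogeneous of degree one in [p'] in the form [S = p' . dS/dp'].

    A generating function with this property preserves the Liouville form
    ([homogeneous_generating_function]): computing its differential once from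
    [p = dS/dq], [q' = dS/dp'] and once from [S = p' . q'] gives
    [p dq + q' dp' = dS = p' dq' + q' dp'], and [q' dp'] cancels.  This is an
    identity of forms in the mixed coordinates [(q, p')]; it is pulled back to
    [(q, p)] along the map [(q, p) |-> (q, p')], which is differentiable because
    the one-step map is. *)

(** * Differential calculus of vector- and matrix-valued maps *)

(** Reduces directional derivatives along which a map is affine to algebra; no
    differentiability in other directions is involved. *)
Lemma is_derive_line {R : realType} {V W : normedModType R} (f : V -> W)
    (x v : V) (c : W) :
  (forall h : R, f (h *: v + x) = f x + h *: c) -> is_derive x v f c.
Proof.
move=> fE.
have qE : h^-1 *: ((f \o shift x) (h *: v) - f x) @[h --> 0^'] --> c.
  apply: cvg_near_cst; near=> h.
  rewrite /= fE addrAC subrr add0r scalerA mulVf ?scale1r //.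
  by near: h; exact: nbhs_dnbhs_neq.
apply: DeriveDef; first by apply/cvg_ex; exists c.
exact: cvg_lim qE.
Unshelve. all: by end_near. Qed.

Lemma differentiable_fst {R : realType} {V W : normedModType R} (x : V * W) :
  differentiable (fst : V * W -> V) x.
Proof. by apply: linear_differentiable => y; exact: cvg_fst. Qed.

Lemma differentiable_snd {R : realType} {V W : normedModType R} (x : V * W) :
  differentiable (snd : V * W -> W) x.
Proof. by apply: linear_differentiable => y; exact: cvg_snd. Qed.

Lemma diff_fst {R : realType} {U V W : normedModType R} (F : U -> V * W) x v :
  differentiable F x -> 'd (fst \o F) x v = ('d F x v).1.
Proof.
move=> dF; rewrite diff_comp //=; last exact: differentiable_fst.
by rewrite diff_lin // => y; exact: cvg_fst.
Qed.

Lemma differentiable_entry {R : realType} {V : normedModType R} {m n : nat}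
    (F : V -> 'M[R]_(m, n)) x i j :
  differentiable F x -> differentiable (fun y => F y i j : R) x.
Proof.
move=> dF; apply: (@differentiable_comp _ _ _ _ F (fun N => N i j : R)) => //.
exact: differentiable_coord.
Qed.

Lemma differentiable_bigsum {R : realType} {V W : normedModType R} {n : nat}
    (F : 'I_n -> V -> W) x :
  (forall i, differentiable (F i) x) ->
  differentiable (fun y => \sum_(i < n) F i y) x.
Proof.
by move=> dF; rewrite -fct_sumE; exact: differentiable_sum.
Qed.

Lemma differentiable_mx {R : realType} {V : normedModType R} {m n : nat}
    (F : V -> 'M[R]_(m, n)) x :
  (forall i j, differentiable (fun y => F y i j : R) x) -> differentiable F x.
Proof.
move=> dF.
rewrite (_ : F = fun y => \sum_i \sum_j F y i j *: delta_mx i j).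
  apply: differentiable_bigsum => i; apply: differentiable_bigsum => j.
  exact: differentiableZl.
by apply/funext => y; exact: matrix_sum_delta.
Qed.

Lemma differentiable_row {R : realType} {m n : nat} {V : normedModType R}
    (F : V -> 'M[R]_(m, n)) i x :
  differentiable F x -> differentiable (fun z => row i (F z)) x.
Proof.
move=> dF; apply: differentiable_mx => k j.
rewrite (_ : (fun y => _) = fun y => F y i j);
  first exact: differentiable_entry.
by apply/funext => y; rewrite mxE.
Qed.

Lemma differentiable_col_mx {R : realType} {m1 m2 n : nat} {V : normedModType R}
    (F1 : V -> 'M[R]_(m1, n)) (F2 : V -> 'M[R]_(m2, n)) x :
  differentiable F1 x -> differentiable F2 x ->
  differentiable (fun z => col_mx (F1 z) (F2 z)) x.
Proof.
move=> dF1 dF2; apply: differentiable_mx => i j.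
case: (splitP i) => k ik.
  have -> : i = lshift _ k by exact/val_inj.
  rewrite (_ : (fun y => _) = fun y => F1 y k j);
    first exact: differentiable_entry.
  by apply/funext => y; rewrite col_mxEu.
have -> : i = rshift _ k by exact/val_inj.
rewrite (_ : (fun y => _) = fun y => F2 y k j);
  first exact: differentiable_entry.
by apply/funext => y; rewrite col_mxEd.
Qed.

Lemma smooth_differentiable {R : realType} {V W : normedModType R} (U : set V)
    (F : V -> W) x :
  smooth_on U F -> U x -> differentiable F x.
Proof. by move=> /(_ 1%N) [dF _]; exact: dF. Qed.

Lemma dot_delta {R : realType} {n : nat} (x : 'rV[R]_n) i :
  dot (delta_mx 0 i) x = x 0 i.
Proof.
rewrite /dot (bigD1 i) //= big1 => [|j ji]; rewrite mxE eqxx.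
  by rewrite eqxx mul1r addr0.
by rewrite (negbTE ji) mul0r.
Qed.

Lemma dotZl {R : realType} {n : nat} (a : R) (x y : 'rV[R]_n) :
  dot (a *: x) y = a * dot x y.
Proof. by rewrite /dot mulr_sumr; apply: eq_bigr => i _; rewrite mxE mulrA. Qed.

Lemma dotDl {R : realType} {n : nat} (x y z : 'rV[R]_n) :
  dot (x + y) z = dot x z + dot y z.
Proof.
by rewrite /dot -big_split; apply: eq_bigr => i _; rewrite mxE mulrDl.
Qed.

Lemma differentiable_dot {R : realType} {V : normedModType R} {n : nat}
    (F G : V -> 'rV[R]_n) x :
  differentiable F x -> differentiable G x ->
  differentiable (fun y => dot (F y) (G y)) x.
Proof.
move=> dF dG; apply: differentiable_bigsum => i.
by apply: differentiableM; exact: differentiable_entry.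
Qed.

Lemma diff_entry {R : realType} {V : normedModType R} {m n : nat}
    (F : V -> 'M[R]_(m, n)) x v i j :
  differentiable F x -> 'd (fun y => F y i j : R) x v = 'd F x v i j.
Proof.
move=> dF; rewrite -deriveE; last exact: differentiable_entry.
by rewrite -(deriveE _ dF) derive_mx ?mxE //; exact: diff_derivable.
Qed.

Lemma derive_dot {R : realType} {V : normedModType R} {n : nat}
    (F G : V -> 'rV[R]_n) x v :
  differentiable F x -> differentiable G x ->
  'D_v (fun y => dot (F y) (G y)) x =
  dot ('d F x v) (G x) + dot (F x) ('d G x v).
Proof.
move=> dF dG.
have dFi i := differentiable_entry _ _ 0 i dF.
have dGi i := differentiable_entry _ _ 0 i dG.
rewrite /dot -fct_sumE derive_sum => [|i].
  rewrite -big_split; apply: eq_bigr => i _ /=.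
  rewrite [LHS](deriveM (diff_derivable (dFi i)) (diff_derivable (dGi i))).
  rewrite (deriveE _ (dFi i)) (deriveE _ (dGi i)) (diff_entry _ _ _ _ _ dF).
  by rewrite (diff_entry _ _ _ _ _ dG) addrC /GRing.scale /= [_ * G x 0 i]mulrC.
by apply/diff_derivable/differentiableM.
Qed.

(** * Generating functions of type [S(q, p')] *)

Lemma differentiable_grad2 {R : realType} {N : nat}
    (S : 'rV[R]_N * 'rV[R]_N -> R) (U : set ('rV[R]_N * 'rV[R]_N)) y :
  smooth_on (W := R) U S -> U y -> differentiable (grad2 S) y.
Proof.
move=> smS Uy; apply: differentiable_mx => i j.
have [_ /(_ ((0, delta_mx 0 j) : 'rV[R]_N * 'rV[R]_N)) [dD _]] := smS 2%N.
rewrite (_ : (fun _ => _) = fun z =>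
  'D_((0, delta_mx 0 j) : 'rV[R]_N * 'rV[R]_N) S z); first exact: dD.
by apply/funext => z; rewrite mxE.
Qed.

Lemma diff_grad {R : realType} {N : nat} (S : 'rV[R]_N * 'rV[R]_N -> R) y u :
  differentiable S y ->
  'd S y u = dot (grad1 S y) u.1 + dot u.2 (grad2 S y).
Proof.
move=> dS.
have uE : u = (\sum_i u.1 0 i *: (delta_mx 0 i, 0)) +
              \sum_i u.2 0 i *: (0, delta_mx 0 i).
  case: u => a b /=; apply/pair_equal_spec; rewrite !raddf_sum /=; split.
    rewrite [X in _ + X]big1 ?addr0 => [|i _]; last by rewrite scaler0.
    by rewrite [LHS]row_sum_delta.
  rewrite [X in X + _]big1 ?add0r => [|i _]; last by rewrite scaler0.
  by rewrite [LHS]row_sum_delta.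
rewrite [in LHS]uE linearD !linear_sum /dot; congr (_ + _);
  apply: eq_bigr => i _.
  by rewrite linearZ mxE deriveE // mulrC.
by rewrite linearZ mxE deriveE.
Qed.

(** The dependence of the stationary point on the parameter contributes
    [dA(0, dX)], a derivative of [A(y, .)] at a stationary point, hence zero.
    Stationarity only speaks of directional derivatives, so the chain rule needs
    the joint differentiability of [A]. *)
Lemma envelope {R : realType} {V W : normedModType R} (A : V * W -> R)
    (X : V -> W) (y v : V) :
  differentiable A (y, X y) -> differentiable X y ->
  stationary (fun w => A (y, w)) (X y) ->
  'D_v (fun y' => A (y', X y')) y = 'D_v (fun y' => A (y', X y)) y.
Proof.
move=> dA dX stat.
have chain (U : normedModType R) (f : U -> V) (g : U -> W) (u h : U) :
    differentiable f u -> differentiable g u -> differentiable A (f u, g u) ->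
  'D_h (fun z => A (f z, g z)) u = 'd A (f u, g u) ('d f u h, 'd g u h).
  move=> df dg dA'.
  have dfg : differentiable (fun z => (f z, g z)) u.
    exact: differentiable_pair.
  apply: (etrans (deriveE h (differentiable_comp dfg dA'))).
  apply: (etrans (congr1 (fun k => k h) (diff_comp dfg dA'))).
  exact: (congr1 (fun k => 'd A (f u, g u) (k h)) (diff_pair df dg)).
have dcst (U U' : normedModType R) (c : U') (u h : U) : 'd (cst c) u h = 0.
  by rewrite diff_cst.
have differentiable_id (U : normedModType R) (u : U) : differentiable id u by [].
have did (U : normedModType R) (u h : U) : 'd id u h = h.
  by rewrite diff_val.
have stat0 h : 'd A (y, X y) (0, h) = 0.
  have := chain _ (cst y) id (X y) h (differentiable_cst _ _) (differentiable_id _ _) dA.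
  by rewrite dcst did => <-; have [] := stat h.
apply: (etrans (chain _ id X y v (differentiable_id _ _) dX dA)).
have := chain _ id (cst (X y)) y v (differentiable_id _ _) (differentiable_cst _ _) dA.
rewrite dcst !did => ->.
rewrite (_ : (v, 'd X y v) = (v, 0) + (0, 'd X y v)); last first.
  by apply/pair_equal_spec; rewrite /= addr0 add0r.
by rewrite linearD stat0 addr0.
Qed.

(** Both ways of computing [dS] contain [q' dp']; what remains is
    [p dq = p' dq'].  The hypothesis [S = p' . dS/dp'] is Euler's relation for
    homogeneity of degree one in [p']. *)
Lemma homogeneous_generating_function {R : realType} {N : nat}
    (S : 'rV[R]_N * 'rV[R]_N -> R) (U D : set ('rV[R]_N * 'rV[R]_N))
    (Phi : 'rV[R]_N * 'rV[R]_N -> 'rV[R]_N * 'rV[R]_N) :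
  open U -> open D ->
  (forall y, U y -> differentiable S y) ->
  (forall y, U y -> differentiable (grad2 S) y) ->
  (forall y, U y -> S y = dot y.2 (grad2 S y)) ->
  (forall x, D x -> differentiable Phi x) ->
  (forall x, D x -> let y := (x.1, (Phi x).2) in
    [/\ U y, x.2 = grad1 S y & (Phi x).1 = grad2 S y]) ->
  forall x v, D x -> pullback Phi (liouville N) x v = liouville N x v.
Proof.
move=> oU oD dS dg SE dPhi gen x v Dx.
have [Uy pE qE] := gen x Dx.
set y := (x.1, (Phi x).2) in Uy pE qE.
pose psi z := (z.1, (Phi z).2) : 'rV[R]_N * 'rV[R]_N.
have dP := dPhi _ Dx.
have dfst := differentiable_fst x.
have dsnd : differentiable (snd \o Phi) x.
  by apply: differentiable_comp => //; exact: differentiable_snd.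
have dpsi : differentiable psi x by exact: differentiable_pair.
set u := 'd psi x v.
have u1 : u.1 = v.1.
  rewrite -(diff_fst _ _ _ dpsi) (_ : fst \o psi = fst) // diff_lin //.
  by move=> z; exact: cvg_fst.
(* The relation q' = dS/dp' (q, p') holds on the open set D, so it may be
   differentiated in (q, p). *)
have dq' : ('d Phi x v).1 = 'd (grad2 S) y u.
  have dq : differentiable (fst \o Phi) x.
    by apply: differentiable_comp => //; exact: differentiable_fst.
  have dgy := dg y Uy.
  apply: (etrans (esym (diff_fst _ _ v dP))).
  apply: (etrans (esym (deriveE v dq))).
  have nearE : {near x, fst \o Phi =1 grad2 S \o psi}.
    have : \forall z \near x, D z by exact: open_nbhs_nbhs.
    by apply: filterS => z Dz; have [] := gen z Dz.
  apply: (etrans (near_eq_derive v nearE)).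
  apply: (etrans (deriveE v (differentiable_comp dpsi dgy))).
  by have := congr1 (fun h => h v) (diff_comp dpsi dgy).
have E : 'd S y u = dot u.2 (grad2 S y) + dot y.2 ('d (grad2 S) y u).
  apply: (etrans (esym (deriveE u (dS y Uy)))).
  have nearE : {near y, S =1 fun z => dot z.2 (grad2 S z)}.
    have : \forall z \near y, U z by exact: open_nbhs_nbhs.
    by apply: filterS => z Uz; exact: SE.
  apply: (etrans (near_eq_derive u nearE)).
  apply: (etrans (derive_dot _ _ _ _ (differentiable_snd y) (dg y Uy))).
  have sndE : 'd (snd : 'rV[R]_N * 'rV[R]_N -> 'rV[R]_N) y u = u.2.
    by rewrite diff_lin // => z; exact: cvg_snd.
  by have := congr1 (fun a => dot a (grad2 S y) + dot y.2 ('d (grad2 S) y u)) sndE.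
have := etrans (esym E) (diff_grad _ _ u (dS _ Uy)); rewrite addrC => /addIr pdq.
apply: (etrans (congr1 (dot (Phi x).2) dq')); apply: (etrans pdq).
by have := congr2 (@dot R N) (esym pE) u1.
Qed.

(** * The Galerkin bracket *)

Lemma differentiable_qd {R : realType} {N s r : nat} {V : normedModType R}
    (G : galerkin R s r) (qs : V -> 'M[R]_(s.+1, N)) (eta : R) x :
  differentiable qs x -> differentiable (fun z => qd G (qs z) eta) x.
Proof.
move=> dqs; apply: differentiable_bigsum => mu; apply: differentiableZ.
exact: differentiable_row.
Qed.

Lemma differentiable_qd_dot {R : realType} {N s r : nat} {V : normedModType R}
    (G : galerkin R s r) (dt : R) (qs : V -> 'M[R]_(s.+1, N)) (eta : R) x :
  differentiable qs x -> differentiable (fun z => qd_dot G dt (qs z) eta) x.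
Proof.
move=> dqs; apply: differentiableZ; apply: differentiable_bigsum => mu.
by apply: differentiableZ; exact: differentiable_row.
Qed.

Lemma differentiable_action {R : realType} {N K s r : nat} (G : galerkin R s r)
    (H : 'rV[R]_N -> 'rV[R]_N -> R) (HH : 'rV[R]_N -> 'rV[R]_N -> 'rV[R]_K)
    (dt : R) (dZ : 'rV[R]_K) :
  (forall x, differentiable (fun z : 'rV[R]_N * 'rV[R]_N => H z.1 z.2) x) ->
  (forall x, differentiable (fun z : 'rV[R]_N * 'rV[R]_N => HH z.1 z.2) x) ->
  forall x, differentiable
    (fun z : ('rV[R]_N * 'rV[R]_N) * ('M[R]_(s, N) * 'M[R]_(r, N)) =>
       action G H HH dt dZ z.1 z.2) x.
Proof.
move=> dH dHH x.
have d11 : differentiable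
    (fun z : ('rV[R]_N * 'rV[R]_N) * ('M[R]_(s, N) * 'M[R]_(r, N)) => z.1.1) x.
  apply: (differentiable_comp (differentiable_fst _)).
  exact: differentiable_fst.
have d12 : differentiable
    (fun z : ('rV[R]_N * 'rV[R]_N) * ('M[R]_(s, N) * 'M[R]_(r, N)) => z.1.2) x.
  apply: (differentiable_comp (differentiable_fst _)).
  exact: differentiable_snd.
have d21 : differentiable
    (fun z : ('rV[R]_N * 'rV[R]_N) * ('M[R]_(s, N) * 'M[R]_(r, N)) => z.2.1) x.
  apply: (differentiable_comp (differentiable_snd _)).
  exact: differentiable_fst.
have d22 : differentiable
    (fun z : ('rV[R]_N * 'rV[R]_N) * ('M[R]_(s, N) * 'M[R]_(r, N)) => z.2.2) x.
  apply: (differentiable_comp (differentiable_snd _)).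
  exact: differentiable_snd.
have dqs := differentiable_col_mx _ _ _ d11 d21.
have dQP i := differentiable_pair (differentiable_qd G _ (node G i) x dqs)
  (differentiable_row _ i _ d22).
apply: differentiableD; first apply: differentiableB.
- by apply: differentiable_dot => //; exact: differentiable_row.
- apply: differentiableZ; apply: differentiable_bigsum => i.
  apply: differentiableZ; apply: differentiableB.
    apply: differentiable_dot; first exact: differentiable_row.
    exact: differentiable_qd_dot.
  exact: (differentiable_comp (dQP i) (dH _)).
- apply: differentiable_bigsum => i; apply: differentiableZ.
  apply: differentiable_dot; last exact: differentiable_cst.
  exact: (differentiable_comp (dQP i) (dHH _)).
Qed.

Lemma action_shift_momentum {R : realType} {N K s r : nat} (G : galerkin R s r)
    (H : 'rV[R]_N -> 'rV[R]_N -> R) (HH : 'rV[R]_N -> 'rV[R]_N -> 'rV[R]_K)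
    (dt : R) (dZ : 'rV[R]_K)
    (q p b : 'rV[R]_N) (w : 'M[R]_(s, N) * 'M[R]_(r, N)) :
  action G H HH dt dZ (q, p + b) w =
  action G H HH dt dZ (q, p) w + dot b (row ord_max (col_mx q w.1)).
Proof. by rewrite /action /= dotDl; ring. Qed.

(** Everything in the bracket except [p' . q^s] is homogeneous of degree one in
    the internal momenta, hence equal to its own derivative in the direction of
    these momenta, which is zero at a stationary point. *)
Lemma stationary_action_value {R : realType} {N K s r : nat} (G : galerkin R s r)
    (H : 'rV[R]_N -> 'rV[R]_N -> R) (HH : 'rV[R]_N -> 'rV[R]_N -> 'rV[R]_K)
    (dt : R) (dZ : 'rV[R]_K)
    (y : 'rV[R]_N * 'rV[R]_N) (w : 'M[R]_(s, N) * 'M[R]_(r, N)) :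
  (forall a q p, H q (a *: p) = a * H q p) ->
  (forall a q p, HH q (a *: p) = a *: HH q p) ->
  stationary (action G H HH dt dZ y) w ->
  action G H HH dt dZ y w = dot y.2 (row ord_max (col_mx y.1 w.1)).
Proof.
move=> hH hHH stat; set b := dot _ _.
pose v : 'M[R]_(s, N) * 'M[R]_(r, N) := (0, w.2).
suff [_] : is_derive w v (action G H HH dt dZ y) (action G H HH dt dZ y w - b).
  by have [_ ->] := stat v => /esym/eqP; rewrite subr_eq0 => /eqP.
apply: is_derive_line => h.
have row_scale i : row i (h *: w.2 + w.2) = (h + 1) *: row i w.2.
  by rewrite -[X in _ + X]scale1r -scalerDl linearZ.
rewrite /action /= !scaler0 add0r -/b.
under eq_bigr do rewrite row_scale dotZl hH -mulrBr mulrCA.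
rewrite -mulr_sumr.
under [X in _ + X = _]eq_bigr do rewrite row_scale hHH dotZl mulrCA.
rewrite -mulr_sumr /GRing.scale /=.
ring.
Qed.

Theorem proposition3p3 (R : realType) (N K s r : nat)
  (* driving path *)
  (alpha t0 t1 : R) (halpha : 1 / 3 < alpha <= 1 / 2) (ht : t0 < t1)
  (Z : R -> 'rV[R]_K) (ZZ : R -> R -> 'M[R]_K)
  (hZ : geometric_rough_path alpha t0 t1 Z ZZ)
  (* time step *)
  (tk tk1 : R) (htk : t0 <= tk) (htk1 : tk < tk1) (htk2 : tk1 <= t1)
  (* scheme *)
  (G : galerkin R s r)
  (* Hamiltonians, linear in p *)
  (f : 'rV[R]_N -> 'rV[R]_N) (sigma : 'rV[R]_N -> 'M[R]_(N, K))
  (hf : smooth_on [set: 'rV[R]_N] f) (hsigma : smooth_on [set: 'rV[R]_N] sigma)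
  (H : 'rV[R]_N -> 'rV[R]_N -> R) (HH : 'rV[R]_N -> 'rV[R]_N -> 'rV[R]_K)
  (hH : forall q p, H q p = dot p (f q))
  (hHH : forall q p, HH q p = p *m sigma q)
  (* solvability and the one-step map *)
  (U D : set ('rV[R]_N * 'rV[R]_N)) (W : set ('M[R]_(s, N) * 'M[R]_(r, N)))
  (X : 'rV[R]_N * 'rV[R]_N -> 'M[R]_(s, N) * 'M[R]_(r, N))
  (Phi : 'rV[R]_N * 'rV[R]_N -> 'rV[R]_N * 'rV[R]_N)
  (hPhi : galerkin_map (action G H HH (tk1 - tk) (incr Z tk tk1)) U D W X Phi) :
  forall x, D x -> forall v, pullback Phi (liouville N) x v = liouville N x v.
Proof.
pose A := action G H HH (tk1 - tk) (incr Z tk tk1).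
pose S y := A y (X y).
have d1 (W' : normedModType R) (F : 'rV[R]_N -> W') (z : 'rV[R]_N * 'rV[R]_N) :
    smooth_on [set: 'rV[R]_N] F -> differentiable (F \o fst) z.
  move=> sF; apply: differentiable_comp; first exact: differentiable_fst.
  exact: (smooth_differentiable _ _ _ sF).
have dA z : differentiable (fun z => A z.1 z.2) z.
  apply: differentiable_action => {}z.
    rewrite (_ : (fun _ => _) = fun z : 'rV[R]_N * 'rV[R]_N => dot z.2 (f z.1)); last first.
      by apply/funext => y; rewrite hH.
    by apply: differentiable_dot; [exact: differentiable_snd|exact: d1].
  apply: differentiable_mx => i j.
  rewrite (_ : (fun _ => _) = 
    fun z : 'rV[R]_N * 'rV[R]_N => \sum_k z.2 i k * sigma z.1 k j); last first.
    by apply/funext => y; rewrite hHH mxE.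
  apply: differentiable_bigsum => k; apply: differentiableM.
    exact: (differentiable_entry _ _ i k (differentiable_snd z)).
  exact: (differentiable_entry _ _ k j (d1 _ _ z hsigma)).
have stat y : U y -> stationary (A y) (X y).
  by move=> Uy; apply/(gm_stationary hPhi Uy (gm_inW hPhi Uy)).
(* Envelope principle; the bracket is affine in p' with slope q^s. *)
have gradE y : U y -> grad2 S y = row ord_max (col_mx y.1 (X y).1).
  move=> Uy; apply/rowP => i; rewrite mxE.
  rewrite (envelope (fun z => A z.1 z.2)) /=; first last.
  - exact: stat.
  - exact: (smooth_differentiable _ _ _ (gm_smoothX hPhi)).
  - exact: dA.
  rewrite -dot_delta.
  suff [] : is_derive y ((0, delta_mx 0 i) : 'rV[R]_N * 'rV[R]_N)
    (fun y' => A y' (X y))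
    (dot (delta_mx 0 i) (row ord_max (col_mx y.1 (X y).1))) by [].
  apply: is_derive_line => h; case: y {Uy} => q p /=.
  rewrite -[X in _ = _ + X]/(h * _) -dotZl /A -action_shift_momentum.
  congr (action _ _ _ _ _ _ _).
  by apply/pair_equal_spec; rewrite /= scaler0 add0r addrC.
have SE y : U y -> S y = dot y.2 (grad2 S y).
  move=> Uy; rewrite gradE //; apply: stationary_action_value; last exact: stat.
    by move=> a q p; rewrite !hH dotZl.
  by move=> a q p; rewrite !hHH scalemxAl.
move=> x Dx v.
apply: (homogeneous_generating_function S U D) => //.
- exact: gm_openU hPhi.
- exact: gm_openD hPhi.
- by move=> y; exact: (smooth_differentiable _ _ _ (gm_smoothS hPhi)).
- by move=> y; exact: (differentiable_grad2 _ _ _ (gm_smoothS hPhi)).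
- exact: gm_diffPhi hPhi.
- move=> [q p] Dz; case PhiE : (Phi (q, p)) => [q' p'] /=.
  by apply/(gm_map hPhi _ _ Dz).
Qed.
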